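(* There exist constants $C_0, C_1, C_2 > 0$ such that the following holds. Let $\Delta > 0$, $t \in \mathbb{R}$, $L \ge 0$, and let $N \ge 1$ and $K \ge 0$ be integers. Let $\mu^t$ be the probability measure on $\mathbb{R}$ with density $\omega^t(s) = \frac{1}{\Delta}\mathbb{I}_{[t-\Delta,t]}(s)$ (the shifted rectangular weighting function of width $\Delta$, whose orthogonal polynomials are the shifted Legendre polynomials on $[t-\Delta,t]$). Let $t-\Delta < t_1 < \dots < t_K < t$ be the observation times lying in the window $[t-\Delta,t]$, with observed values $x_1,\dots,x_K \in \mathbb{R}$. Let $\hat{x} : [t-\Delta,t] \to \mathbb{R}$ be the forward process, which is $L$-Lipschitz on each of the intervals $[t-\Delta,t_1), [t_1,t_2), \dots, [t_K,t]$, and which at each update time $t_i$ is reset to the observation, i.e. $\hat{x}(t_i) = x_i$, with left limit $\hat{x}(t_i^-)$ existing. Let $S_K = \sum_{i=1}^K \lvert \hat{x}(t_i^-) - x_i \rvert$ be the sum of absolute errors between the forward process and the observations incurred at the update steps. Let $\hat{x}_{<t}$ be the reverse reconstruction, i.e. the orthogonal projection of $\hat{x}$ in $L^2(\mu^t)$ onto the space of polynomials of degree at most $N$: $\hat{x}_{<t} = \sum_{n=0}^N c_n(t) P_n^t / \alpha_n^t$, where $P_n^t$ are the orthogonal polynomials for $\mu^t$, $\alpha_n^t = \langle P_n^t, P_n^t\rangle_{\mu^t}$ and $c_n(t) = \int \hat{x}(s) P_n^t(s)\, d\mu^t(s)$. Then $$\lVert \hat{x} - \hat{x}_{<t} \rVert_{\mu^t}^2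 \le C_0 \frac{\Delta^2 L^2 (K+1)^2}{N(2N-1)} + C_1 \Delta L (K+1) S_K\, \xi\!\left(\tfrac{3}{2}, N\right) + C_2 S_K^2\, \xi\!\left(\tfrac{3}{2}, N\right),$$ where $\lVert g \rVert_{\mu^t}^2 = \int g(s)^2 \, d\mu^t(s)$ and $\xi(s,a) = \sum_{n=0}^\infty (n+a)^{-s}$ is the Hurwitz zeta function.
   Context: This concerns PolyODE, a neural ODE model for irregularly sampled time series. The model maintains a forward prediction $\hat{x}(t)$ of the time series, which between observations evolves continuously according to a learned ODE, and which at each observation time $t_i$ is reset to the observed value $x_i$ (the update step). Simultaneously, it maintains coefficients $c_n(t)$ of the orthogonal projection of the forward process $\hat{x}$ restricted to the window $[t-\Delta,t]$ onto polynomials of degree at most $N$, with respect to the time-varying measure $\mu^t$ with density $\frac{1}{\Delta}\mathbb{I}_{[t-\Delta,t]}$; the reverse reconstruction $\hat{x}_{<t}$ is the polynomial built from these coefficients. $L$ is the Lipschitz constant of the forward process between observations, $K$ the number of observations in $[t-\Delta,t]$, and $S_K$ the sum of the absolute jump sizes of the forward process at the update steps. The constants $C_0, C_1, C_2$ do not depend on $\Delta, L, K, N, t$, the observations or the forward process. *)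

(* Defs.v *)
From Stdlib Require Import Reals.
From Coquelicot Require Import Coquelicot.
Open Scope R_scope.

(* Integral against mu^t, the probability measure with density
   (1/Delta) * indicator of [t - Delta, t]. *)
Definition mu_int (Delta t : R) (g : R -> R) : R :=
  / Delta * RInt g (t - Delta) t.

Definition mu_norm2 (Delta t : R) (g : R -> R) : R :=
  mu_int Delta t (fun s => (g s) ^ 2).

Definition poly_le (N : nat) (a : nat -> R) (s : R) : R :=
  sum_f_R0 (fun k => a k * s ^ k) N.

Definition is_orth_proj (Delta t : R) (N : nat) (f p : R -> R) : Prop :=
  (exists a : nat -> R, forall s, p s = poly_le N a s) /\
  (forall b : nat -> R,
     mu_int Delta t (fun s => (f s - p s) * poly_le N b s) = 0).

Definition hurwitz_zeta (s a : R) : R :=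
  Series (fun n : nat => Rpower (INR n + a) (- s)).

Definition knot (Delta t : R) (K : nat) (ts : nat -> R) (i : nat) : R :=
  if Nat.eqb i 0 then t - Delta
  else if Nat.leb i K then ts i else t.

Definition in_piece (Delta t : R) (K : nat) (ts : nat -> R) (i : nat) (s : R) : Prop :=
  knot Delta t K ts i <= s /\
  (if Nat.ltb i K then s < knot Delta t K ts (S i) else s <= t).

Definition sum_1_to (K : nat) (f : nat -> R) : R :=
  List.fold_right Rplus 0 (List.map f (List.seq 1 K)).

(* Main.v *)
Require Import Defs.
From Stdlib Require Import Reals Lra Lia Psatz List.
From Coquelicot Require Import Coquelicot.
Open Scope R_scope.

(* Write [xhat = g + h] on the window, where [h] is the sum of the jumps placed at the
   observation times and [g] is [L]-Lipschitz.  Replacing each jump by a linear ramp of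
   width [Delta / sqrt N] costs [S_K^2 / sqrt N] in squared norm and leaves a function [F]
   with Lipschitz constant [L + S_K * sqrt N / Delta].  By optimality of the orthogonal
   projection it then suffices to approximate [F] in [L^2] by polynomials of degree at
   most [N] at rate [1 / N] (Jackson), and to note [zeta (3/2, N) >= 1 / sqrt N].

   For the Jackson estimate, a Bernstein polynomial [P] of [F] is uniformly close to [F]
   and satisfies [|P'| <= Lip F].  With [w s = (s - a) (b - s)], the Legendre operator
   [p |-> - (w p')'] is symmetric, preserves the degree, and multiplies the leading
   coefficient in degree [n] by [n (n + 1)]; hence the component of [P] of degree
   greater than [N] has squared norm at most the integral of [w P'^2] divided by
   [(N + 1) (N + 2)]. *)

(** * Polynomial functions of bounded degree *)

Definition poly_fun (n : nat) (f : R -> R) : Prop :=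
  exists a, forall s, f s = poly_le n a s.

Lemma poly_fun_ext n f g :
  (forall s, f s = g s) -> poly_fun n f -> poly_fun n g.
Proof. intros E [a Ha]; exists a; intros s; rewrite <- E; apply Ha. Qed.

Lemma poly_fun_plus n f g :
  poly_fun n f -> poly_fun n g -> poly_fun n (fun s => f s + g s).
Proof.
  intros [a Ha] [b Hb]; exists (fun k => a k + b k); intros s.
  rewrite Ha, Hb; unfold poly_le; rewrite <- sum_plus.
  apply sum_eq; intros; ring.
Qed.

Lemma poly_fun_scal n c f : poly_fun n f -> poly_fun n (fun s => c * f s).
Proof.
  intros [a Ha]; exists (fun k => c * a k); intros s.
  rewrite Ha; unfold poly_le; rewrite scal_sum.
  apply sum_eq; intros; ring.
Qed.

Lemma poly_fun_minus n f g :
  poly_fun n f -> poly_fun n g -> poly_fun n (fun s => f s - g s).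
Proof.
  intros Hf Hg.
  apply poly_fun_ext with (fun s => f s + -1 * g s); [intros; ring|].
  apply poly_fun_plus; [assumption | now apply poly_fun_scal].
Qed.

Lemma poly_fun_monomial n : poly_fun n (fun s => s ^ n).
Proof.
  exists (fun k => if Nat.eqb k n then 1 else 0); intros s.
  unfold poly_le; destruct n as [|n]; [simpl; ring|].
  rewrite tech5, Nat.eqb_refl, sum_eq_R0; [ring|].
  intros k Hk; replace (Nat.eqb k (S n)) with false; [ring|].
  symmetry; apply Nat.eqb_neq; lia.
Qed.

Lemma poly_fun_S n f : poly_fun n f -> poly_fun (S n) f.
Proof.
  (* The coefficient sequence is arbitrary beyond index [n], so the entry at [S n] has to be set to
     zero. *)
  intros [a Ha]; exists (fun k => if Nat.eqb k (S n) then 0 else a k); intros s.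
  rewrite Ha; unfold poly_le; rewrite tech5, Nat.eqb_refl, Rmult_0_l, Rplus_0_r.
  apply sum_eq; intros k Hk; replace (Nat.eqb k (S n)) with false; [ring|].
  symmetry; apply Nat.eqb_neq; lia.
Qed.

Lemma poly_fun_0_inv f : poly_fun 0 f -> exists c, forall s, f s = c.
Proof.
  intros [a Ha]; exists (a 0%nat); intros s; rewrite Ha; unfold poly_le; simpl; ring.
Qed.

Lemma poly_fun_S_inv n f :
  poly_fun (S n) f ->
  exists c g, poly_fun n g /\ forall s, f s = c * s ^ S n + g s.
Proof.
  intros [a Ha]; exists (a (S n)), (poly_le n a); split; [now exists a|].
  intros s; rewrite Ha; unfold poly_le; rewrite tech5; ring.
Qed.

Lemma poly_fun_const n c : poly_fun n (fun _ => c).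
Proof.
  induction n as [|n IH]; [|now apply poly_fun_S].
  exists (fun _ => c); intros s; unfold poly_le; simpl; ring.
Qed.

Lemma poly_fun_mul_id n f : poly_fun n f -> poly_fun (S n) (fun s => s * f s).
Proof.
  revert f; induction n as [|n IH]; intros f Hf.
  - destruct (poly_fun_0_inv f Hf) as [c Hc].
    apply poly_fun_ext with (fun s => c * s ^ 1); [intros s; rewrite Hc; ring|].
    apply poly_fun_scal, poly_fun_monomial.
  - destruct (poly_fun_S_inv n f Hf) as (c & g & Hg & E).
    apply poly_fun_ext with (fun s => c * s ^ S (S n) + s * g s).
    + intros s; rewrite E; simpl; ring.
    + apply poly_fun_plus; [apply poly_fun_scal, poly_fun_monomial|].
      now apply poly_fun_S, IH.
Qed.

Lemma is_derive_eq (f : R -> R) (s l l' : R) : l = l' -> is_derive f s l -> is_derive f s l'.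
Proof. now intros ->. Qed.

Lemma poly_fun_is_derive n f :
  poly_fun n f ->
  exists d, poly_fun n d /\ forall s, is_derive f s (d s).
Proof.
  revert f; induction n as [|n IH]; intros f Hf.
  - destruct (poly_fun_0_inv f Hf) as [c Hc].
    exists (fun _ => 0); split; [apply poly_fun_const|]; intros s.
    apply is_derive_ext with (fun _ => c); [intros; symmetry; apply Hc|].
    apply @is_derive_const.
  - destruct (poly_fun_S_inv n f Hf) as (c & g & Hg & E).
    destruct (IH g Hg) as (d & Hd & Dg).
    exists (fun s => (c * INR (S n)) * s ^ n + d s); split.
    + apply poly_fun_S, poly_fun_plus; [apply poly_fun_scal, poly_fun_monomial|assumption].
    + intros s.
      apply is_derive_ext with (fun s => c * s ^ S n + g s); [intros; symmetry; apply E|].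
      apply @is_derive_plus; [|apply Dg].
      auto_derive; [trivial|]; change (match n with 0%nat => 1 | S _ => INR n + 1 end) with (INR (S n)); ring.
Qed.

(** * Continuity and Riemann integrals of real functions *)

Definition cont (f : R -> R) : Prop := forall s, continuous f s.

Lemma cont_ext f g : (forall s, f s = g s) -> cont f -> cont g.
Proof. intros E H s; apply continuous_ext with f; [exact E|apply H]. Qed.

Lemma cont_const c : cont (fun _ => c).
Proof. intros s; apply continuous_const. Qed.

Lemma cont_id : cont (fun s => s).
Proof. intros s; apply continuous_id. Qed.

Lemma cont_plus f g : cont f -> cont g -> cont (fun s => f s + g s).
Proof. intros Hf Hg s; apply @continuous_plus; [apply Hf|apply Hg]. Qed.

Lemma cont_mult f g : cont f -> cont g -> cont (fun s => f s * g s).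
Proof. intros Hf Hg s; apply @continuous_mult; [apply Hf|apply Hg]. Qed.

Lemma cont_minus f g : cont f -> cont g -> cont (fun s => f s - g s).
Proof. intros Hf Hg s; apply @continuous_minus; [apply Hf|apply Hg]. Qed.

Lemma cont_opp f : cont f -> cont (fun s => - f s).
Proof. intros Hf s; apply @continuous_opp; apply Hf. Qed.

Lemma cont_sqr f : cont f -> cont (fun s => f s ^ 2).
Proof.
  intros Hf; apply cont_ext with (fun s => f s * f s); [intros; ring|].
  now apply cont_mult.
Qed.

Lemma cont_poly_fun n f : poly_fun n f -> cont f.
Proof.
  intros Hf s; destruct (poly_fun_is_derive n f Hf) as (d & _ & D).
  apply @ex_derive_continuous; exists (d s); apply D.
Qed.

Lemma cont_Derive_poly_fun n f : poly_fun n f -> cont (Derive f).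
Proof.
  intros Hf; destruct (poly_fun_is_derive n f Hf) as (d & Hd & D).
  apply cont_ext with d; [|now apply cont_poly_fun with n].
  intros s; symmetry; apply is_derive_unique, D.
Qed.

Lemma cont_ex_RInt f a b : cont f -> ex_RInt f a b.
Proof. intros Hf; apply @ex_RInt_continuous; intros; apply Hf. Qed.

Create HintDb cont.
#[local] Hint Resolve cont_const cont_id cont_plus cont_mult cont_minus cont_opp cont_sqr
  cont_ex_RInt : cont.

Lemma RInt_Rext (f g : R -> R) (a b : R) : (forall s, f s = g s) -> RInt f a b = RInt g a b.
Proof. intros E; apply RInt_ext; intros; apply E. Qed.

Lemma RInt_Rplus f g a b : ex_RInt f a b -> ex_RInt g a b ->
  RInt (fun s => f s + g s) a b = RInt f a b + RInt g a b.
Proof. apply (@RInt_plus R_CompleteNormedModule). Qed.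

Lemma RInt_Rscal c f a b : ex_RInt f a b ->
  RInt (fun s => c * f s) a b = c * RInt f a b.
Proof. intros; now apply (@RInt_scal R_CompleteNormedModule). Qed.

Lemma RInt_Rconst c a b : RInt (fun _ => c) a b = (b - a) * c.
Proof. apply (@RInt_const R_CompleteNormedModule). Qed.

(** * The unweighted inner product and projection onto polynomials *)

Definition ip (a b : R) (f g : R -> R) : R := RInt (fun s => f s * g s) a b.

Lemma ip_ext a b f f' g g' :
  (forall s, f s = f' s) -> (forall s, g s = g' s) -> ip a b f g = ip a b f' g'.
Proof. intros E E'; apply RInt_ext; intros; now rewrite E, E'. Qed.

Lemma ip_comm a b f g : ip a b f g = ip a b g f.
Proof. apply RInt_ext; intros; apply Rmult_comm. Qed.

Lemma ip_lin_l a b c f g h : cont f -> cont g -> cont h ->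
  ip a b (fun s => f s + c * g s) h = ip a b f h + c * ip a b g h.
Proof.
  intros Hf Hg Hh; unfold ip.
  rewrite (RInt_Rext _ (fun s => f s * h s + c * (g s * h s))).
  - rewrite RInt_Rplus, RInt_Rscal; auto with cont.
  - intros; ring.
Qed.

Lemma ip_lin_r a b c f g h : cont f -> cont g -> cont h ->
  ip a b h (fun s => f s + c * g s) = ip a b h f + c * ip a b h g.
Proof.
  intros; rewrite ip_comm, ip_lin_l, (ip_comm _ _ f), (ip_comm _ _ g); auto.
Qed.

Lemma ip_nonneg a b f : a <= b -> cont f -> 0 <= ip a b f f.
Proof.
  intros Hab Hf; apply RInt_ge_0; auto with cont; intros; nra.
Qed.

(* If [e] has norm [0], then by Cauchy-Schwarz every [c] works. *)
Lemma ip_proj_line a b f e : a <= b -> cont f -> cont e ->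
  exists c, ip a b (fun s => f s + c * e s) e = 0.
Proof.
  intros Hab Hf He.
  destruct (Req_dec (ip a b e e) 0) as [Z|NZ].
  - exists 0; rewrite ip_lin_l, Z by assumption.
    destruct (Req_dec (ip a b f e) 0) as [Z'|NZ']; [rewrite Z'; ring|].
    exfalso.
    (* With [e] of norm zero, this [l] would give [f + l * e] the squared norm [-1]. *)
    set (l := - (ip a b f f + 1) / (2 * ip a b f e)).
    assert (H := ip_nonneg a b (fun s => f s + l * e s) Hab ltac:(auto with cont)).
    rewrite ip_lin_l, !ip_lin_r, Z, (ip_comm a b e f) in H by auto with cont.
    assert (E : l * ip a b f e = - (ip a b f f + 1) / 2) by (unfold l; field; auto).
    rewrite Rmult_0_r, Rplus_0_r, E in H; lra.
  - exists (- ip a b f e / ip a b e e); rewrite ip_lin_l by assumption; field; auto.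
Qed.

(** Gram-Schmidt by induction on the degree: the monomial of degree [S M] minus its projection [T]
    is a direction [e] orthogonal to all lower degrees, so correcting the projection [Q] along [e]
    keeps the orthogonality already obtained. *)
Lemma poly_proj_exists a b M f : a <= b -> cont f ->
  exists Q, poly_fun M Q /\
    forall r, poly_fun M r -> ip a b (fun s => f s - Q s) r = 0.
Proof.
  intros Hab; revert f; induction M as [|M IH]; intros f Hf.
  - destruct (ip_proj_line a b f (fun _ => 1) Hab Hf (cont_const 1)) as [c Hc].
    exists (fun _ => - c); split; [apply poly_fun_const|]; intros r Hr.
    destruct (poly_fun_0_inv r Hr) as [k Hk].
    rewrite (ip_ext _ _ _ (fun s => f s + c * 1) _ (fun _ => 0 + k * 1)).
    + rewrite ip_lin_r, Hc, Rmult_0_r by auto with cont.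
      unfold ip; rewrite (RInt_Rext _ (fun _ => 0)), RInt_Rconst by (intros; ring); ring.
    + intros; ring.
    + intros s; rewrite Hk; ring.
  - destruct (IH (fun s => s ^ S M)
      (cont_poly_fun _ _ (poly_fun_monomial (S M)))) as (T & HT & OT).
    destruct (IH f Hf) as (Q & HQ & OQ).
    set (e := fun s => s ^ S M - T s) in OT.
    assert (He : poly_fun (S M) e)
      by (apply poly_fun_minus; [apply poly_fun_monomial | now apply poly_fun_S]).
    assert (Ce := cont_poly_fun _ _ He); assert (CQ := cont_poly_fun _ _ HQ).
    destruct (ip_proj_line a b (fun s => f s - Q s) e Hab) as [c Hc]; auto with cont.
    exists (fun s => Q s - c * e s); split.
    { apply poly_fun_minus; [now apply poly_fun_S | now apply poly_fun_scal]. }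
    intros r Hr; destruct (poly_fun_S_inv M r Hr) as (k & g & Hg & E).
    assert (Hg' : poly_fun M (fun s => g s + k * T s))
      by (apply poly_fun_plus; [assumption | now apply poly_fun_scal]).
    assert (Cg := cont_poly_fun _ _ Hg').
    rewrite (ip_ext _ _ _ (fun s => (f s - Q s) + c * e s) _
      (fun s => (g s + k * T s) + k * e s)).
    + rewrite ip_lin_r, Hc, ip_lin_l, OQ, OT by auto with cont; ring.
    + intros; ring.
    + intros s; rewrite E; unfold e; ring.
Qed.

(** * The Legendre operator and its energy form *)

Section Legendre.

Variables a b : R.
Hypothesis Hab : a < b.

(** The factor [1 - s^2] of Legendre's equation, carried over from [[-1, 1]] to [[a, b]]; it
    vanishes at both ends. *)
Definition weight (s : R) : R := (s - a) * (b - s).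

Lemma cont_weight : cont weight.
Proof. unfold weight; auto with cont. Qed.
#[local] Hint Resolve cont_weight : cont.

(** The Dirichlet form of the Legendre operator: integrating by parts turns it into the inner
    product of [p] with the operator applied to [r]. *)
Definition energy (p r : R -> R) : R :=
  RInt (fun s => weight s * Derive p s * Derive r s) a b.

Lemma legendre_op_monomial n :
  exists low, poly_fun n low /\
    forall s, is_derive (fun s => weight s * Derive (fun x => x ^ S n) s) s
      (- (INR (S n) * INR (S (S n)) * s ^ S n + low s)).
Proof.
  assert (D : forall s, Derive (fun x => x ^ S n) s = INR (S n) * s ^ n).
  { intros s; apply is_derive_unique; auto_derive; [trivial|];
    change (match n with 0%nat => 1 | S _ => INR n + 1 end) with (INR (S n)); ring. }
  destruct n as [|n].
  (* Degree 1 is separate: the general formula has a term two degrees below the top. *)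
  - exists (fun _ => - (a + b)); split; [apply poly_fun_const|]; intros s.
    apply is_derive_ext with (fun s => weight s * (INR 1 * s ^ 0));
      [intros; now rewrite D|].
    unfold weight; auto_derive; [trivial|]; simpl; ring.
  - exists (fun s => - INR (S (S n)) ^ 2 * (a + b) * s ^ S n
                   + INR (S (S n)) * INR (S n) * (a * b) * s ^ n); split.
    + apply poly_fun_plus; [|apply poly_fun_S]; apply poly_fun_scal, poly_fun_monomial.
    + intros s.
      apply is_derive_ext with (fun s => weight s * (INR (S (S n)) * s ^ S n));
        [intros; now rewrite D|].
      unfold weight; auto_derive; [trivial|].
      change (match n with 0%nat => 1 | S _ => INR n + 1 end) with (INR (S n));
      rewrite !S_INR; simpl pow; ring.
Qed.

Lemma legendre_op_lin p q c u v n m :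
  poly_fun n p -> poly_fun m q ->
  (forall s, is_derive (fun s => weight s * Derive p s) s (u s)) ->
  (forall s, is_derive (fun s => weight s * Derive q s) s (v s)) ->
  forall s, is_derive (fun s => weight s * Derive (fun x => c * p x + q x) s) s
    (c * u s + v s).
Proof.
  intros Hp Hq Du Dv s.
  destruct (poly_fun_is_derive _ _ Hp) as (dp & _ & Dp).
  destruct (poly_fun_is_derive _ _ Hq) as (dq & _ & Dq).
  apply is_derive_ext with
    (fun s => plus (scal c (weight s * Derive p s)) (weight s * Derive q s)).
  - intros x; rewrite Derive_plus, Derive_scal.
    + unfold plus, scal; simpl; unfold mult; simpl; ring.
    + apply ex_derive_scal; exists (dp x); apply Dp.
    + exists (dq x); apply Dq.
  - apply @is_derive_plus; [apply @is_derive_scal; apply Du | apply Dv].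
Qed.

Lemma legendre_op n r : poly_fun n r ->
  exists Ar, poly_fun n Ar /\
    forall s, is_derive (fun s => weight s * Derive r s) s (- Ar s).
Proof.
  revert r; induction n as [|n IH]; intros r Hr.
  - destruct (poly_fun_0_inv r Hr) as [c Hc].
    exists (fun _ => 0); split; [apply poly_fun_const|]; intros s.
    apply is_derive_ext with (fun _ => 0).
    + intros x; rewrite (Derive_ext r (fun _ => c)), Derive_const by exact Hc.
      symmetry; apply Rmult_0_r.
    + apply is_derive_eq with 0; [ring|apply @is_derive_const].
  - destruct (poly_fun_S_inv n r Hr) as (c & g & Hg & E).
    destruct (IH g Hg) as (Ag & HAg & Dg).
    destruct (legendre_op_monomial n) as (low & Hlow & Dl).
    exists (fun s => c * (INR (S n) * INR (S (S n)) * s ^ S n + low s) + Ag s); split.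
    + apply poly_fun_plus; [apply poly_fun_scal, poly_fun_plus|]; try now apply poly_fun_S.
      apply poly_fun_scal, poly_fun_monomial.
    + intros s.
      apply is_derive_ext with (fun s => weight s * Derive (fun x => c * x ^ S n + g x) s).
      { intros x; rewrite (Derive_ext r (fun x => c * x ^ S n + g x)); auto. }
      apply is_derive_eq with
        (c * (- (INR (S n) * INR (S (S n)) * s ^ S n + low s)) + - Ag s); [ring|].
      apply (legendre_op_lin _ _ c _ _ _ _ (poly_fun_monomial (S n)) Hg Dl Dg).
Qed.

(** The leading coefficient is multiplied by [(n + 1) * (n + 2)], so the operator acts on [r] as
    this scalar up to degree at most [n]. If [r] is orthogonal to those degrees, its energy is the
    scalar times its squared norm. *)
Lemma legendre_op_top n r : poly_fun (S n) r ->
  exists low, poly_fun n low /\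
    forall s, is_derive (fun s => weight s * Derive r s) s
      (- (INR (S n) * INR (S (S n)) * r s + low s)).
Proof.
  intros Hr; destruct (poly_fun_S_inv n r Hr) as (c & g & Hg & E).
  destruct (legendre_op n g Hg) as (Ag & HAg & Dg).
  destruct (legendre_op_monomial n) as (low & Hlow & Dl).
  exists (fun s => c * low s + Ag s + - (INR (S n) * INR (S (S n))) * g s); split.
  - apply poly_fun_plus; [apply poly_fun_plus|]; auto using poly_fun_scal.
  - intros s.
    apply is_derive_ext with (fun s => weight s * Derive (fun x => c * x ^ S n + g x) s).
    { intros x; rewrite (Derive_ext r (fun x => c * x ^ S n + g x)); auto. }
    apply is_derive_eq with
      (c * (- (INR (S n) * INR (S (S n)) * s ^ S n + low s)) + - Ag s); [rewrite E; ring|].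
    apply (legendre_op_lin _ _ c _ _ _ _ (poly_fun_monomial (S n)) Hg Dl Dg).
Qed.

(** The integrand of the difference is the derivative of [p * weight * r'], and [weight] kills the
    boundary terms. *)
Lemma energy_by_parts n m p r Ar : poly_fun n p -> poly_fun m r -> cont Ar ->
  (forall s, is_derive (fun s => weight s * Derive r s) s (- Ar s)) ->
  energy p r = ip a b p Ar.
Proof.
  intros Hp Hr CA D.
  assert (Cp := cont_poly_fun _ _ Hp); assert (CDp := cont_Derive_poly_fun _ _ Hp).
  assert (CDr := cont_Derive_poly_fun _ _ Hr).
  destruct (poly_fun_is_derive _ _ Hp) as (dp & _ & Dp).
  assert (I : is_RInt (fun s => weight s * Derive p s * Derive r s + -1 * (p s * Ar s)) a b
    (minus (p b * (weight b * Derive r b)) (p a * (weight a * Derive r a)))).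
  { apply (is_RInt_derive (fun s => p s * (weight s * Derive r s))).
    - intros s _.
      apply is_derive_eq with (Derive p s * (weight s * Derive r s) + p s * - Ar s); [ring|].
      apply (is_derive_mult p (fun s => weight s * Derive r s)); [|apply D|intros; apply Rmult_comm].
      apply Derive_correct; exists (dp s); apply Dp.
    - intros s _.
      assert (cont (fun s => weight s * Derive p s * Derive r s + -1 * (p s * Ar s)))
        by auto 10 with cont.
      auto. }
  apply (@is_RInt_unique R_CompleteNormedModule) in I.
  assert (J : RInt (fun s => weight s * Derive p s * Derive r s
                + -1 * (p s * Ar s)) a b = energy p r + -1 * ip a b p Ar).
  { rewrite RInt_Rplus, RInt_Rscal; auto 10 with cont. }
  assert (energy p r + -1 * ip a b p Ar = 0); [|lra].
  rewrite <- J; etransitivity; [apply I|].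
  unfold minus, plus, opp, weight; simpl; ring.
Qed.

Lemma energy_nonneg n p : poly_fun n p -> 0 <= energy p p.
Proof.
  intros Hp; assert (C := cont_Derive_poly_fun _ _ Hp).
  apply RInt_ge_0; [lra|auto with cont|].
  intros s Hs; unfold weight; rewrite Rmult_assoc.
  apply Rmult_le_pos; [nra|apply Rle_0_sqr].
Qed.

Lemma energy_sum n p r c : poly_fun n p -> poly_fun n r -> energy p r = c ->
  energy (fun s => p s + r s) (fun s => p s + r s) = energy p p + 2 * c + energy r r.
Proof.
  intros Hp Hr <-; unfold energy.
  assert (Cp := cont_Derive_poly_fun _ _ Hp); assert (Cr := cont_Derive_poly_fun _ _ Hr).
  destruct (poly_fun_is_derive _ _ Hp) as (dp & _ & Dp).
  destruct (poly_fun_is_derive _ _ Hr) as (dr & _ & Dr).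
  rewrite (RInt_Rext _ (fun s => weight s * Derive p s * Derive p s
    + 2 * (weight s * Derive p s * Derive r s) + weight s * Derive r s * Derive r s)).
  - rewrite !RInt_Rplus, RInt_Rscal; auto 10 with cont.
  - intros s.
    rewrite Derive_plus; [|exists (dp s); apply Dp|exists (dr s); apply Dr]; ring.
Qed.

(* Peel off the component [Rm] of [P] of top degree: it is orthogonal to the rest
   both for the inner product and for the energy, and its energy is
   [deg * (deg + 1)] times its squared norm. *)
Lemma poly_approx_energy k N P : poly_fun (k + N) P ->
  exists q, poly_fun N q /\
    INR (S N) * INR (S (S N)) * ip a b (fun s => P s - q s) (fun s => P s - q s)
      <= energy P P.
Proof.
  revert P; induction k as [|k IH]; intros P HP; simpl Nat.add in HP.
  - exists P; split; [assumption|].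
    rewrite (ip_ext _ _ _ (fun _ => 0) _ (fun _ => 0)) by (intros; ring).
    unfold ip; rewrite RInt_Rconst.
    assert (H := energy_nonneg _ _ HP).
    replace (_ * _ * _) with 0 by ring; exact H.
  - assert (CP := cont_poly_fun _ _ HP).
    destruct (poly_proj_exists a b (k + N) P ltac:(lra) CP) as (Q & HQ & OQ).
    set (Rm := fun s => P s - Q s) in OQ.
    assert (HQ' := poly_fun_S _ _ HQ).
    assert (HR : poly_fun (S (k + N)) Rm) by now apply poly_fun_minus.
    assert (CQ := cont_poly_fun _ _ HQ); assert (CR := cont_poly_fun _ _ HR).
    destruct (IH Q HQ) as (q & Hq & Iq).
    assert (Cq := cont_poly_fun _ _ Hq).
    exists q; split; [assumption|].
    destruct (legendre_op _ _ HQ) as (AQ & HAQ & DQ).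
    destruct (legendre_op_top _ _ HR) as (low & Hlow & DR).
    assert (Cl := cont_poly_fun _ _ Hlow).
    (* The operator keeps [Q] within degree [k + N], and [Rm] is orthogonal to all such
       polynomials. *)
    assert (ERQ : energy Rm Q = 0).
    { rewrite (energy_by_parts _ _ _ _ AQ HR HQ); auto.
      now apply cont_poly_fun with (k + N)%nat. }
    set (lam := INR (S (k + N)) * INR (S (S (k + N)))) in DR.
    assert (ERR : energy Rm Rm = lam * ip a b Rm Rm).
    { rewrite (energy_by_parts _ _ _ _ (fun s => lam * Rm s + low s) HR HR); auto with cont.
      rewrite (ip_ext _ _ _ Rm _ (fun s => low s + lam * Rm s)) by (intros; ring).
      rewrite ip_lin_r, OQ by auto with cont; ring. }
    assert (EP : energy P P = energy Rm Rm + 2 * 0 + energy Q Q).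
    { rewrite <- (energy_sum _ Rm Q 0 HR HQ' ERQ); unfold energy.
      apply RInt_ext; intros s _.
      rewrite (Derive_ext P (fun s => Rm s + Q s)) by (intros; unfold Rm; ring).
      reflexivity. }
    assert (OQq : ip a b Rm (fun s => Q s - q s) = 0).
    { apply OQ, poly_fun_minus; [assumption|].
      clear - Hq; induction k; [assumption|now apply poly_fun_S]. }
    assert (NP : ip a b (fun s => P s - q s) (fun s => P s - q s)
      = ip a b Rm Rm + ip a b (fun s => Q s - q s) (fun s => Q s - q s)).
    { rewrite (ip_ext _ _ _ (fun s => Rm s + 1 * (Q s - q s)) _
        (fun s => Rm s + 1 * (Q s - q s))) by (intros; unfold Rm; ring).
      rewrite ip_lin_l, !ip_lin_r, (ip_comm _ _ (fun s => Q s - q s) Rm), OQq by auto with cont; ring. }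
    rewrite NP, EP, ERR.
    assert (NR := ip_nonneg a b Rm ltac:(lra) CR).
    (* Every peeled component has degree at least [N + 1], so its factor is at least the one for
       degree [N + 1]. *)
    assert (Hlam : INR (S N) * INR (S (S N)) <= lam).
    { unfold lam; rewrite <- !mult_INR; apply le_INR; nia. }
    nra.
Qed.

(** On [[a, b]] the weight is at most [(b - a)^2 / 4], its value at the midpoint. *)
Lemma energy_le n P L : poly_fun n P ->
  (forall s, a <= s <= b -> Rabs (Derive P s) <= L) ->
  energy P P <= (b - a) ^ 3 * L ^ 2 / 4.
Proof.
  intros HP HL; assert (C := cont_Derive_poly_fun _ _ HP).
  apply Rle_trans with (RInt (fun _ => (b - a) ^ 2 * L ^ 2 / 4) a b).
  - apply RInt_le; [lra|auto with cont|auto with cont|].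
    intros s Hs; rewrite Rmult_assoc.
    assert (Derive P s * Derive P s <= L ^ 2).
    { specialize (HL s ltac:(lra)); revert HL; unfold Rabs; destruct Rcase_abs; nra. }
    assert (0 <= weight s <= (b - a) ^ 2 / 4).
    { unfold weight; split; [nra|].
      assert (0 <= (2 * s - a - b) ^ 2) by apply pow2_ge_0. nra. }
    replace ((b - a) ^ 2 * L ^ 2 / 4) with ((b - a) ^ 2 / 4 * L ^ 2) by field.
    apply Rmult_le_compat; try lra. nra.
  - rewrite RInt_Rconst; right; field.
Qed.

End Legendre.

(** * Bernstein polynomials and the Jackson estimate *)

(* The Bernstein polynomial of [u 0, ..., u m] on [[a, b]], by de Casteljau's recursion. *)
Fixpoint bernstein (a b : R) (m : nat) (u : nat -> R) (s : R) : R :=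
  match m with
  | O => u O
  | S m => (b - s) / (b - a) * bernstein a b m u s
           + (s - a) / (b - a) * bernstein a b m (fun k => u (S k)) s
  end.

Section Bernstein.

Variables a b : R.
Hypothesis Hab : a < b.

Lemma bernstein_S m u s :
  bernstein a b (S m) u s = (b - s) / (b - a) * bernstein a b m u s
    + (s - a) / (b - a) * bernstein a b m (fun k => u (S k)) s.
Proof. reflexivity. Qed.

Lemma bernstein_ext m u v s :
  (forall k, u k = v k) -> bernstein a b m u s = bernstein a b m v s.
Proof.
  revert u v; induction m as [|m IH]; intros u v E; [apply E|].
  rewrite !bernstein_S, (IH u v), (IH (fun k => u (S k)) (fun k => v (S k))); auto.
Qed.

Lemma bernstein_const m c s : bernstein a b m (fun _ => c) s = c.
Proof.
  induction m as [|m IH]; [reflexivity|]; rewrite bernstein_S, IH; field; lra.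
Qed.

Lemma poly_fun_bernstein m u : poly_fun m (bernstein a b m u).
Proof.
  revert u; induction m as [|m IH]; intros u; [apply poly_fun_const|].
  apply poly_fun_ext with (fun s =>
    (b / (b - a) * bernstein a b m u s + - (a / (b - a)) * bernstein a b m (fun k => u (S k)) s)
    + s * (/ (b - a) * bernstein a b m (fun k => u (S k)) s + - / (b - a) * bernstein a b m u s)).
  - intros s; simpl; field; lra.
  - apply poly_fun_plus.
    + apply poly_fun_S, poly_fun_plus; apply poly_fun_scal, IH.
    + apply poly_fun_mul_id, poly_fun_plus; apply poly_fun_scal, IH.
Qed.

(** Differentiation yields, up to a factor, the Bernstein polynomial of the forward differences of
    [u]; this carries a Lipschitz bound on the samples over to the derivative. *)
Lemma is_derive_bernstein m u s :
  is_derive (bernstein a b (S m) u) s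
    (INR (S m) / (b - a) * (bernstein a b m (fun k => u (S k)) s - bernstein a b m u s)).
Proof.
  revert u; induction m as [|m IH]; intros u.
  - simpl; auto_derive; [trivial|]. field; lra.
  - assert (D1 := IH u); assert (D2 := IH (fun k => u (S k))).
    set (f1 := bernstein a b (S m) u) in *.
    set (f2 := bernstein a b (S m) (fun k => u (S k))) in *.
    apply is_derive_ext with (fun s => (b - s) / (b - a) * f1 s + (s - a) / (b - a) * f2 s);
      [reflexivity|].
    apply is_derive_unique in D1 as U1; apply is_derive_unique in D2 as U2.
    auto_derive.
    + repeat split; eexists; eassumption.
    + replace (Derive (fun x => f1 x) s) with (Derive f1 s) by reflexivity.
      replace (Derive (fun x => f2 x) s) with (Derive f2 s) by reflexivity.
      rewrite U1, U2; unfold f1, f2; simpl bernstein; rewrite !S_INR; field; lra.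
Qed.

Lemma bernstein_le m u v s : a <= s <= b ->
  (forall k, u k <= v k) -> bernstein a b m u s <= bernstein a b m v s.
Proof.
  intros Hs; revert u v; induction m as [|m IH]; intros u v E; [apply E|]; simpl.
  apply Rplus_le_compat; apply Rmult_le_compat_l; auto;
    apply Rmult_le_pos; try lra; apply Rlt_le, Rinv_0_lt_compat; lra.
Qed.

Lemma bernstein_minus m u v s :
  bernstein a b m (fun k => u k - v k) s = bernstein a b m u s - bernstein a b m v s.
Proof.
  revert u v; induction m as [|m IH]; intros u v; [reflexivity|]; simpl.
  rewrite (IH u v), (IH (fun k => u (S k)) (fun k => v (S k))); ring.
Qed.

(* With [c = 0] and [h = 1] this is the second moment of the binomial law. *)
Lemma bernstein_quadratic m c h al be s :
  let y := (s - a) / (b - a) in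
  bernstein a b m (fun k => al + be * (c + INR k * h) ^ 2) s
  = al + be * ((c + INR m * h * y) ^ 2 + INR m * h ^ 2 * (y * (1 - y))).
Proof.
  intros y; revert c; induction m as [|m IH]; intros c; [simpl; ring|].
  rewrite bernstein_S, IH.
  rewrite (bernstein_ext m _ (fun k => al + be * ((c + h) + INR k * h) ^ 2))
    by (intros; rewrite S_INR; ring).
  rewrite IH.
  replace ((b - s) / (b - a)) with (1 - y) by (unfold y; field; lra).
  fold y; rewrite S_INR; ring.
Qed.

Lemma bernstein_abs_le m u s e : a <= s <= b ->
  (forall k, Rabs (u k) <= e) -> Rabs (bernstein a b m u s) <= e.
Proof.
  intros Hs Hu.
  apply Rabs_le; split.
  - rewrite <- (bernstein_const m (- e) s); apply bernstein_le; [assumption|].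
    intros k; specialize (Hu k); apply Rabs_le_between in Hu; lra.
  - rewrite <- (bernstein_const m e s); apply bernstein_le; [assumption|].
    intros k; specialize (Hu k); apply Rabs_le_between in Hu; lra.
Qed.

Variables (F : R -> R) (L : R).
Hypothesis HL : 0 <= L.
Hypothesis HF : forall x y, Rabs (F x - F y) <= L * Rabs (x - y).

(** The derivative bound comes from forward differences, each at most [L * h]. For the error,
    [Rabs (F x - F s)] is bounded by a quadratic in [x - s], whose Bernstein polynomial is explicit;
    monotonicity then transfers the bound. *)
Lemma bernstein_lipschitz_approx eta : 0 < eta ->
  exists m P, poly_fun m P /\
    (forall s, a <= s <= b -> Rabs (Derive P s) <= L) /\
    (forall s, a <= s <= b -> Rabs (P s - F s) <= L * eta).
Proof.
  intros Heta.
  (* The degree [S m] exceeds [(b - a)^2 / (4 * eta^2)], which brings the variance of the sample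
     points below [eta^2]. *)
  destruct (nfloor_ex ((b - a) ^ 2 / (4 * eta ^ 2))) as [m [_ Hm]].
  { apply Rmult_le_pos; [apply pow2_ge_0|]. apply Rlt_le, Rinv_0_lt_compat; nra. }
  rewrite <- S_INR in Hm.
  assert (Hp : 0 < INR (S m)) by (apply lt_0_INR; lia).
  set (h := (b - a) / INR (S m)).
  set (u := fun k => F (a + INR k * h)).
  exists (S m), (bernstein a b (S m) u); split; [apply poly_fun_bernstein|]; split; intros s Hs.
  - rewrite (is_derive_unique _ _ _ (is_derive_bernstein m u s)), <- bernstein_minus.
    rewrite Rabs_mult, Rabs_pos_eq by (apply Rlt_le, Rdiv_lt_0_compat; lra).
    apply Rle_trans with (INR (S m) / (b - a) * (L * h)).
    + apply Rmult_le_compat_l; [apply Rlt_le, Rdiv_lt_0_compat; lra|].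
      apply bernstein_abs_le; [assumption|]; intros k; unfold u.
      eapply Rle_trans; [apply HF|]; right.
      rewrite S_INR; replace (_ - _) with h by ring.
      rewrite Rabs_pos_eq; [reflexivity|]. apply Rlt_le, Rdiv_lt_0_compat; lra.
    + right; unfold h; field; lra.
  - set (be := L / (2 * eta)).
    set (v := fun k => L * eta / 2 + be * ((a - s) + INR k * h) ^ 2).
    assert (V : bernstein a b (S m) v s <= L * eta).
    { unfold v; rewrite bernstein_quadratic.
      set (y := (s - a) / (b - a)).
      (* The sample points have mean [s], so only the variance term is left. *)
      replace (a - s + INR (S m) * h * y) with 0 by (unfold h, y; field; lra).
      replace (L * eta) with (L * eta / 2 + be * eta ^ 2) at 2 by (unfold be; field; lra).
      apply Rplus_le_compat_l, Rmult_le_compat_l.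
      { apply Rmult_le_pos; [assumption|]. apply Rlt_le, Rinv_0_lt_compat; lra. }
      assert (y * (1 - y) <= / 4) by (assert (0 <= (1 - 2 * y) ^ 2) by apply pow2_ge_0; nra).
      assert (E : INR (S m) * h ^ 2 * / 4 <= eta ^ 2).
      { apply Rmult_lt_compat_r with (r := 4 * eta ^ 2) in Hm; [|nra].
        replace (_ / _ * _) with ((b - a) ^ 2) in Hm by (field; lra).
        replace (INR (S m) * h ^ 2 * / 4) with ((b - a) ^ 2 / (4 * INR (S m)))
          by (unfold h; field; lra).
        apply Rmult_le_reg_r with (4 * INR (S m)); [lra|].
        replace (_ / _ * _) with ((b - a) ^ 2) by (field; lra). lra. }
      assert (0 <= INR (S m) * h ^ 2) by (apply Rmult_le_pos; [lra|apply pow2_ge_0]).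
      nra. }
    assert (B : forall k, Rabs (u k - F s) <= v k).
    { intros k; unfold u, v; eapply Rle_trans; [apply HF|].
      replace (a + INR k * h - s) with (a - s + INR k * h) by ring.
      set (z := a - s + INR k * h).
      rewrite <- (pow2_abs z); set (r := Rabs z).
      (* Completing the square: the quadratic majorant touches [L * r] at [r = eta]. *)
      replace (L * eta / 2 + be * r ^ 2) with (L * r + be * (eta - r) ^ 2)
        by (unfold be; field; lra).
      assert (0 <= be * (eta - r) ^ 2); [|lra].
      apply Rmult_le_pos; [|apply pow2_ge_0].
      apply Rmult_le_pos; [assumption|]. apply Rlt_le, Rinv_0_lt_compat; lra. }
    rewrite <- (bernstein_const (S m) (F s) s) at 1.
    rewrite <- bernstein_minus.
    apply Rabs_le; split.
    + apply Rle_trans with (bernstein a b (S m) (fun k => 0 - v k) s);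
        [rewrite bernstein_minus, bernstein_const; lra|].
      apply bernstein_le; [assumption|]; intros k; specialize (B k).
      apply Rabs_le_between in B; lra.
    + apply Rle_trans with (bernstein a b (S m) v s); [|lra].
      apply bernstein_le; [assumption|]; intros k; specialize (B k).
      apply Rabs_le_between in B; lra.
Qed.

Lemma cont_lipschitz : cont F.
Proof.
  intros s; apply filterlim_locally; intros e.
  (* Dividing by [L + 1] covers the case [L = 0]. *)
  assert (He : 0 < e / (L + 1)) by (apply Rdiv_lt_0_compat; [apply cond_pos|lra]).
  exists (mkposreal _ He); intros y Hy.
  unfold ball in *; simpl in *; unfold AbsRing_ball, abs, minus, plus, opp in *; simpl in *.
  eapply Rle_lt_trans; [apply HF|].
  apply Rle_lt_trans with ((L + 1) * Rabs (y + - s)).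
  - apply Rmult_le_compat_r; [apply Rabs_pos|lra].
  - replace (pos e) with ((L + 1) * (e / (L + 1))) by (field; lra).
    apply Rmult_lt_compat_l; [lra|exact Hy].
Qed.
#[local] Hint Resolve cont_lipschitz : cont.

(** The Bernstein error with [eta = (b - a) / (2 * N)] and the truncation of [P] to degree [N] each
    contribute at most [(b - a)^3 * L^2 / (2 * N^2)], after [(x + y)^2 <= 2 * x^2 + 2 * y^2]. *)
Lemma jackson_L2 N : (1 <= N)%nat ->
  exists q, poly_fun N q /\
    RInt (fun s => (F s - q s) ^ 2) a b <= (b - a) ^ 3 * L ^ 2 / INR N ^ 2.
Proof.
  intros HN; assert (HN' : 1 <= INR N) by (apply (le_INR 1); assumption).
  destruct (bernstein_lipschitz_approx ((b - a) / (2 * INR N))) as (m & P & HP & DP & EP).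
  { apply Rdiv_lt_0_compat; lra. }
  set (eta := (b - a) / (2 * INR N)) in *.
  assert (HP' : poly_fun (m + N) P).
  { clear - HP; rewrite Nat.add_comm; induction N; [assumption|now apply poly_fun_S]. }
  destruct (poly_approx_energy a b Hab m N P HP') as (q & Hq & Iq).
  assert (EL := energy_le a b Hab _ P L HP DP).
  exists q; split; [assumption|].
  assert (CP := cont_poly_fun _ _ HP); assert (Cq := cont_poly_fun _ _ Hq).
  set (I := ip a b (fun s => P s - q s) (fun s => P s - q s)) in *.
  apply Rle_trans with (2 * ((b - a) * (L * eta) ^ 2) + 2 * I).
  - unfold I, ip; rewrite <- RInt_Rconst, <- !RInt_Rscal, <- RInt_Rplus by auto 10 with cont.
    apply RInt_le; [lra|auto 10 with cont|auto 10 with cont|].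
    intros s Hs; specialize (EP s ltac:(lra)).
    assert ((P s - F s) ^ 2 <= (L * eta) ^ 2).
    { rewrite <- (pow2_abs (P s - F s)). apply pow_incr; split; [apply Rabs_pos|apply EP]. }
    assert (0 <= ((F s - P s) - (P s - q s)) ^ 2) by apply pow2_ge_0.
    nra.
  - assert (HI : I <= (b - a) ^ 3 * L ^ 2 / (4 * INR N ^ 2)).
    { assert (0 <= I) by (apply ip_nonneg; [lra|auto with cont]).
      apply Rmult_le_reg_l with (INR N ^ 2); [nra|].
      apply Rle_trans with ((b - a) ^ 3 * L ^ 2 / 4); [|right; field; lra].
      rewrite !S_INR in Iq; nra. }
    apply Rle_trans with (2 * ((b - a) * (L * eta) ^ 2) + 2 * ((b - a) ^ 3 * L ^ 2 / (4 * INR N ^ 2)));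
      [lra|].
    right; unfold eta; field; lra.
Qed.

End Bernstein.

(** * Finite sums over the observation times *)

Lemma sum_1_to_S K f : sum_1_to (S K) f = sum_1_to K f + f (S K).
Proof.
  unfold sum_1_to; rewrite seq_S, map_app, fold_right_app; simpl.
  generalize (map f (seq 1 K)) as l; induction l as [|x l IH]; simpl; [ring|].
  rewrite IH; ring.
Qed.

Lemma sum_1_to_le K f g :
  (forall i, (1 <= i <= K)%nat -> f i <= g i) -> sum_1_to K f <= sum_1_to K g.
Proof.
  induction K as [|K IH]; intros H; [apply Rle_refl|].
  rewrite !sum_1_to_S; apply Rplus_le_compat; [apply IH; intros|]; apply H; lia.
Qed.

Lemma sum_1_to_ext K f g :
  (forall i, (1 <= i <= K)%nat -> f i = g i) -> sum_1_to K f = sum_1_to K g.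
Proof. intros H; apply Rle_antisym; apply sum_1_to_le; intros; rewrite H; auto; lra. Qed.

Lemma sum_1_to_minus K f g :
  sum_1_to K (fun i => f i - g i) = sum_1_to K f - sum_1_to K g.
Proof.
  induction K as [|K IH]; [unfold sum_1_to; simpl; ring|].
  rewrite !sum_1_to_S, IH; ring.
Qed.

Lemma sum_1_to_scal_r K f c : sum_1_to K (fun i => f i * c) = sum_1_to K f * c.
Proof.
  induction K as [|K IH]; [unfold sum_1_to; simpl; ring|].
  rewrite !sum_1_to_S, IH; ring.
Qed.

Lemma sum_1_to_abs K f : Rabs (sum_1_to K f) <= sum_1_to K (fun i => Rabs (f i)).
Proof.
  induction K as [|K IH]; [unfold sum_1_to; simpl; rewrite Rabs_R0; lra|].
  rewrite !sum_1_to_S; eapply Rle_trans; [apply Rabs_triang|]; lra.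
Qed.

Lemma sum_1_to_nonneg K f :
  (forall i, (1 <= i <= K)%nat -> 0 <= f i) -> 0 <= sum_1_to K f.
Proof.
  intros H; rewrite <- (Rmult_0_r (sum_1_to K (fun _ => 0))), <- sum_1_to_scal_r.
  apply sum_1_to_le; intros; rewrite Rmult_0_r; now apply H.
Qed.

(** With [X] the sum on the left, [Rabs X <= Y <= Sm] gives [X^2 <= Sm * Y]. The bound is linear in
    [e], hence can be integrated term by term. *)
Lemma sum_1_to_weighted_sqr K J d e :
  (forall i, (1 <= i <= K)%nat -> 0 <= d i <= e i /\ e i <= 1) ->
  (sum_1_to K (fun i => J i * d i)) ^ 2
    <= sum_1_to K (fun i => Rabs (J i)) * sum_1_to K (fun i => Rabs (J i) * e i).
Proof.
  intros H.
  set (Sm := sum_1_to K (fun i => Rabs (J i))).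
  set (Y := sum_1_to K (fun i => Rabs (J i) * e i)).
  rewrite <- pow2_abs.
  assert (HX : Rabs (sum_1_to K (fun i => J i * d i)) <= Y).
  { eapply Rle_trans; [apply sum_1_to_abs|]; apply sum_1_to_le; intros i Hi.
    rewrite Rabs_mult; apply Rmult_le_compat_l; [apply Rabs_pos|].
    rewrite Rabs_pos_eq; apply H; assumption. }
  assert (HY : Y <= Sm).
  { apply sum_1_to_le; intros i Hi; rewrite <- (Rmult_1_r (Rabs (J i))) at 2.
    apply Rmult_le_compat_l; [apply Rabs_pos|apply H; assumption]. }
  assert (H0 := Rabs_pos (sum_1_to K (fun i => J i * d i))).
  nra.
Qed.

(** * Steps, ramps and their integrals *)

Definition clamp (lo hi x : R) : R := Rmax lo (Rmin hi x).

Lemma clamp_lipschitz lo hi x y : Rabs (clamp lo hi x - clamp lo hi y) <= Rabs (x - y).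
Proof.
  unfold clamp, Rmin; destruct (Rle_dec hi x), (Rle_dec hi y);
    unfold Rmax; repeat destruct Rle_dec; unfold Rabs; repeat destruct Rcase_abs; lra.
Qed.

Lemma clamp_in lo hi x : lo <= hi -> lo <= clamp lo hi x <= hi.
Proof.
  intros; unfold clamp, Rmin; destruct (Rle_dec hi x);
    unfold Rmax; destruct Rle_dec; lra.
Qed.

Lemma clamp_id lo hi x : lo <= x <= hi -> clamp lo hi x = x.
Proof.
  intros; unfold clamp, Rmin; destruct (Rle_dec hi x);
    unfold Rmax; destruct Rle_dec; lra.
Qed.

(** The value at [tau] itself is 1, because the forward process already has its reset value at an
    observation time. *)
Definition step (tau s : R) : R := if Rle_dec tau s then 1 else 0.

Definition ramp (tau delta s : R) : R := clamp 0 1 ((s - tau) / delta).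

Lemma step_1 tau s : tau <= s -> step tau s = 1.
Proof. intros; unfold step; destruct Rle_dec; lra. Qed.

Lemma step_0 tau s : s < tau -> step tau s = 0.
Proof. intros; unfold step; destruct Rle_dec; lra. Qed.

Lemma ramp_lipschitz tau delta x y : 0 < delta ->
  Rabs (ramp tau delta x - ramp tau delta y) <= / delta * Rabs (x - y).
Proof.
  intros Hd; eapply Rle_trans; [apply clamp_lipschitz|].
  replace ((x - tau) / delta - (y - tau) / delta) with (/ delta * (x - y)) by (field; lra).
  rewrite Rabs_mult, (Rabs_pos_eq (/ delta)); [lra|].
  apply Rlt_le, Rinv_0_lt_compat; lra.
Qed.

(** The ramp starts at [tau] and reaches 1 at [tau + delta]; the upper bound is the indicator of
    [[tau, tau + delta)]. *)
Lemma step_minus_ramp tau delta s : 0 < delta ->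
  0 <= step tau s - ramp tau delta s <= step tau s - step (tau + delta) s.
Proof.
  intros Hd.
  assert (B : 0 <= ramp tau delta s <= 1) by (apply clamp_in; lra).
  destruct (Rlt_le_dec s tau) as [H|H].
  - rewrite !step_0 by lra.
    assert (ramp tau delta s = 0); [|lra].
    assert ((s - tau) / delta <= 0) by (apply Rmult_le_0_r; [lra|apply Rlt_le, Rinv_0_lt_compat; lra]).
    unfold ramp, clamp; rewrite Rmin_right by lra; apply Rmax_left; lra.
  - rewrite (step_1 tau) by lra.
    destruct (Rlt_le_dec s (tau + delta)) as [H'|H'].
    + rewrite step_0 by lra; lra.
    + rewrite step_1 by lra.
      assert (1 <= (s - tau) / delta)
        by (apply Rmult_le_reg_r with delta; [lra|]; field_simplify; lra).
      unfold ramp, clamp; rewrite Rmin_left, Rmax_right by lra; lra.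
Qed.

Lemma is_RInt_zero a b : is_RInt (fun _ => 0) a b 0.
Proof.
  assert (H := @is_RInt_const R_NormedModule a b 0).
  change (is_RInt (fun _ : R => 0) a b ((b - a) * 0)) in H.
  rewrite Rmult_0_r in H; exact H.
Qed.

(** The minimum allows [tau > b], which happens when a ramp ends beyond the window. *)
Lemma is_RInt_step tau a b : a <= b -> a <= tau ->
  is_RInt (step tau) a b (b - Rmin b tau).
Proof.
  intros Hab Ht.
  assert (Z : forall c, a <= c -> c <= tau -> is_RInt (step tau) a c 0).
  { intros c Hc Hc'; apply is_RInt_ext with (fun _ => 0).
    - intros s Hs; rewrite Rmax_right in Hs by assumption; rewrite step_0; [reflexivity|lra].
    - apply is_RInt_zero. }
  destruct (Rle_dec tau b) as [H|H].
  - rewrite Rmin_right by assumption.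
    assert (I : is_RInt (step tau) tau b ((b - tau) * 1)).
    { apply (@is_RInt_ext R_NormedModule (fun _ => 1));
        [|apply (@is_RInt_const R_NormedModule)].
      intros s Hs; rewrite Rmin_left in Hs by assumption; rewrite step_1; [reflexivity|lra]. }
    assert (I' := @is_RInt_Chasles R_NormedModule _ _ _ _ _ _ (Z tau Ht ltac:(lra)) I).
    change (is_RInt (step tau) a b (0 + (b - tau) * 1)) in I'.
    now rewrite Rplus_0_l, Rmult_1_r in I'.
  - rewrite Rmin_left by lra.
    replace (b - b) with 0 by ring. apply Z; lra.
Qed.

Lemma ex_RInt_step_diff tau delta a b : a <= b -> a <= tau -> 0 < delta ->
  exists v, v <= delta /\ is_RInt (fun s => step tau s - step (tau + delta) s) a b v.
Proof.
  intros Hab Ht Hd.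
  exists ((b - Rmin b tau) - (b - Rmin b (tau + delta))); split.
  - unfold Rmin; repeat destruct Rle_dec; lra.
  - apply (@is_RInt_minus R_NormedModule); apply is_RInt_step; lra.
Qed.

(** * Integrability of squares in the presence of jumps *)

(* [ring] does not see through the carrier of Coquelicot's [R_NormedModule]. *)
Ltac ring_R := match goal with |- ?l = ?r => change (@eq R l r) end; ring.

(* A substitute for closure of Riemann integrability under products: unlike plain
   integrability, this property is visibly stable under adding a jump. *)
Definition quad_integrable (a b : R) (u : R -> R) : Prop :=
  forall A B C, cont A -> cont B -> cont C ->
    ex_RInt (fun s => A s + B s * u s + C s * u s ^ 2) a b.

Lemma quad_integrable_ext a b u v : a <= b ->
  (forall s, a < s < b -> u s = v s) -> quad_integrable a b u -> quad_integrable a b v.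
Proof.
  intros Hab E H A B C HA HB HC.
  apply ex_RInt_ext with (fun s => A s + B s * u s + C s * u s ^ 2); [|now apply H].
  intros s Hs; rewrite Rmin_left, Rmax_right in Hs by assumption.
  rewrite E by assumption; reflexivity.
Qed.

Lemma quad_integrable_cont a b u : cont u -> quad_integrable a b u.
Proof. intros Hu A B C HA HB HC; auto with cont. Qed.

(** On either side of [tau] the step is constant, so a quadratic in the new function is again a
    quadratic in [u] with continuous coefficients. *)
Lemma quad_integrable_jump a b u c tau : a <= tau <= b ->
  quad_integrable a b u -> quad_integrable a b (fun s => u s + c * step tau s).
Proof.
  intros Ht H A B C HA HB HC.
  apply ex_RInt_Chasles with tau.
  - apply ex_RInt_ext with (fun s => A s + B s * u s + C s * u s ^ 2).
    + intros s Hs; rewrite Rmax_right in Hs by lra.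
      rewrite step_0 by lra. now rewrite Rmult_0_r, Rplus_0_r.
    + apply (@ex_RInt_Chasles_1 R_CompleteNormedModule) with b; [lra|now apply H].
  - apply ex_RInt_ext with (fun s => (A s + B s * c + C s * c ^ 2)
      + (B s + 2 * c * C s) * u s + C s * u s ^ 2).
    + intros s Hs; rewrite Rmin_left in Hs by lra.
      rewrite step_1 by lra.
      ring_R.
    + apply (@ex_RInt_Chasles_2 R_CompleteNormedModule) with a; [lra|]; apply H; auto with cont.
Qed.

Lemma quad_integrable_jumps a b u J ts K :
  (forall i, (1 <= i <= K)%nat -> a < ts i < b) -> quad_integrable a b u ->
  quad_integrable a b (fun s => u s + sum_1_to K (fun i => J i * step (ts i) s)).
Proof.
  intros Ht Hu; induction K as [|K IH]; intros A B C HA HB HC.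
  - apply ex_RInt_ext with (fun s => A s + B s * u s + C s * u s ^ 2); [|now apply Hu].
    intros s _; unfold sum_1_to; simpl fold_right; now rewrite Rplus_0_r.
  - assert (Q := quad_integrable_jump a b _ (J (S K)) (ts (S K))
      ltac:(specialize (Ht (S K) ltac:(lia)); lra) (IH ltac:(intros; apply Ht; lia))).
    eapply ex_RInt_ext; [|exact (Q A B C HA HB HC)].
    intros s _; rewrite sum_1_to_S; ring_R.
Qed.

Lemma quad_integrable_sqr_minus a b u q : quad_integrable a b u -> cont q ->
  ex_RInt (fun s => (u s - q s) ^ 2) a b.
Proof.
  intros Hu Hq.
  apply ex_RInt_ext with (fun s => q s ^ 2 + (-2 * q s) * u s + 1 * u s ^ 2).
  - intros s _; ring_R.
  - apply Hu; auto with cont.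
Qed.

(** * Optimality of the projection *)

(** Pythagoras: [p - q] has degree at most [N], so the cross term in the expansion of
    [((f - p) + (p - q))^2] integrates to zero. *)
Lemma orth_proj_best Delta t N f p q : 0 < Delta ->
  quad_integrable (t - Delta) t f -> is_orth_proj Delta t N f p -> poly_fun N q ->
  RInt (fun s => (f s - p s) ^ 2) (t - Delta) t
    <= RInt (fun s => (f s - q s) ^ 2) (t - Delta) t.
Proof.
  intros HD Hf [Hp Ho] Hq.
  assert (Hp' : poly_fun N p) by exact Hp.
  assert (Cp := cont_poly_fun _ _ Hp'); assert (Cq := cont_poly_fun _ _ Hq).
  destruct (poly_fun_minus _ _ _ Hp' Hq) as [c Hc].
  assert (O : RInt (fun s => (f s - p s) * (p s - q s)) (t - Delta) t = 0).
  { specialize (Ho c); unfold mu_int in Ho.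
    apply Rmult_integral in Ho; destruct Ho as [Ho|Ho].
    - exfalso; revert Ho; apply Rinv_neq_0_compat; lra.
    - rewrite <- Ho; apply RInt_Rext; intros s; now rewrite Hc. }
  assert (X : ex_RInt (fun s => (f s - p s) * (p s - q s)) (t - Delta) t).
  { apply ex_RInt_ext with
      (fun s => - p s * (p s - q s) + (p s - q s) * f s + 0 * f s ^ 2).
    - intros s _; ring_R.
    - apply Hf; auto with cont. }
  assert (X1 := quad_integrable_sqr_minus _ _ _ _ Hf Cp).
  rewrite (RInt_Rext (fun s => (f s - q s) ^ 2)
    (fun s => (f s - p s) ^ 2 + (2 * ((f s - p s) * (p s - q s)) + (p s - q s) ^ 2)))
    by (intros; ring).
  assert (X2 : ex_RInt (fun s => 2 * ((f s - p s) * (p s - q s))) (t - Delta) t)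
    by now apply (@ex_RInt_scal R_NormedModule).
  assert (X3 : ex_RInt (fun s => (p s - q s) ^ 2) (t - Delta) t) by auto with cont.
  rewrite RInt_Rplus, RInt_Rplus, RInt_Rscal, O; auto.
  - assert (0 <= RInt (fun s => (p s - q s) ^ 2) (t - Delta) t); [|lra].
    apply RInt_ge_0; [lra|assumption|]; intros; apply pow2_ge_0.
  - now apply (@ex_RInt_plus R_NormedModule).
Qed.

(** * Replacing jumps by ramps *)

(** The majorant [G] is [Sm] times a sum of indicators of [[ts i, ts i + delta)] weighted by the
    jump sizes; each indicator integrates to at most [delta]. *)
Lemma jumps_ramps_L2 a b delta J ts K : a <= b -> 0 < delta ->
  (forall i, (1 <= i <= K)%nat -> a < ts i < b) ->
  exists G v, is_RInt G a b v /\
    v <= (sum_1_to K (fun i => Rabs (J i))) ^ 2 * delta /\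
    forall s, (sum_1_to K (fun i => J i * step (ts i) s)
               - sum_1_to K (fun i => J i * ramp (ts i) delta s)) ^ 2 <= G s.
Proof.
  intros Hab Hd Ht.
  set (Sm := sum_1_to K (fun i => Rabs (J i))).
  set (e := fun i s => step (ts i) s - step (ts i + delta) s).
  assert (HS : 0 <= Sm) by (apply sum_1_to_nonneg; intros; apply Rabs_pos).
  assert (I : exists v, is_RInt (fun s => sum_1_to K (fun i => Rabs (J i) * e i s)) a b v
                        /\ v <= Sm * delta).
  { unfold Sm; clear HS Sm; induction K as [|K IH].
    - exists 0; unfold sum_1_to; simpl; split; [|lra].
      apply is_RInt_zero.
    - destruct IH as (v & Iv & Bv); [intros; apply Ht; lia|].
      destruct (ex_RInt_step_diff (ts (S K)) delta a b) as (w & Bw & Iw); auto.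
      { specialize (Ht (S K) ltac:(lia)); lra. }
      exists (plus v (scal (Rabs (J (S K))) w)); split.
      + apply is_RInt_ext with (fun s => plus (sum_1_to K (fun i => Rabs (J i) * e i s))
          (scal (Rabs (J (S K))) (e (S K) s))).
        * intros s _; now rewrite sum_1_to_S.
        * apply @is_RInt_plus; [assumption|]. now apply @is_RInt_scal.
      + rewrite sum_1_to_S; unfold plus, scal; simpl; unfold mult; simpl.
        assert (B := Rabs_pos (J (S K))); nra. }
  destruct I as (v & Iv & Bv).
  exists (fun s => scal Sm (sum_1_to K (fun i => Rabs (J i) * e i s))), (scal Sm v).
  split; [now apply @is_RInt_scal|]; split.
  - unfold scal; simpl; unfold mult; simpl; nra.
  - intros s; rewrite <- sum_1_to_minus.
    rewrite (sum_1_to_ext K _ (fun i => J i * (step (ts i) s - ramp (ts i) delta s)))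
      by (intros; ring).
    apply sum_1_to_weighted_sqr; intros i _; split.
    + now apply step_minus_ramp.
    + unfold e, step; repeat destruct Rle_dec; lra.
Qed.

Lemma ramps_lipschitz delta J ts K x y : 0 < delta ->
  Rabs (sum_1_to K (fun i => J i * ramp (ts i) delta x)
        - sum_1_to K (fun i => J i * ramp (ts i) delta y))
    <= sum_1_to K (fun i => Rabs (J i)) / delta * Rabs (x - y).
Proof.
  intros Hd; rewrite <- sum_1_to_minus.
  eapply Rle_trans; [apply sum_1_to_abs|].
  unfold Rdiv; rewrite Rmult_assoc, <- sum_1_to_scal_r.
  apply sum_1_to_le; intros i _.
  rewrite <- Rmult_minus_distr_l, Rabs_mult.
  apply Rmult_le_compat_l; [apply Rabs_pos|now apply ramp_lipschitz].
Qed.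

(** * A lower bound for the Hurwitz zeta function *)

Lemma Rpower_m32 x : 0 < x -> Rpower x (- (3 / 2)) = / (x * sqrt x).
Proof.
  intros Hx; rewrite Rpower_Ropp; f_equal.
  replace (3 / 2) with (1 + / 2) by field.
  rewrite Rpower_plus, Rpower_1, Rpower_sqrt by assumption; reflexivity.
Qed.

(* Telescoping comparison with [/ sqrt k - / sqrt (k + 1)]. *)
Lemma hurwitz_zeta_3_2_ge N : (1 <= N)%nat -> / sqrt (INR N) <= hurwitz_zeta (3 / 2) (INR N).
Proof.
  intros HN; assert (HN' : 1 <= INR N) by (apply (le_INR 1); assumption).
  set (v := fun n => / sqrt (INR n + INR N)).
  set (d := fun n => v n - v (S n)).
  (* The first bound gives the inequality between the sums; the one with factor 6 gives the
     convergence of the zeta series that the comparison requires. *)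
  assert (B : forall n, 0 <= d n <= Rpower (INR n + INR N) (- (3 / 2)) /\
                Rpower (INR n + INR N) (- (3 / 2)) <= 6 * d n).
  { intros n; unfold d, v; rewrite S_INR.
    assert (Hn := pos_INR n).
    rewrite Rpower_m32 by lra.
    replace (INR n + 1 + INR N) with (INR n + INR N + 1) by ring.
    set (x := INR n + INR N); assert (1 <= x) by (unfold x; lra).
    assert (P := sqrt_lt_R0 x ltac:(lra)); assert (Q := sqrt_lt_R0 (x + 1) ltac:(lra)).
    assert (P2 := sqrt_sqrt x ltac:(lra)); assert (Q2 := sqrt_sqrt (x + 1) ltac:(lra)).
    set (p := sqrt x) in *; set (q := sqrt (x + 1)) in *.
    assert (p < q) by nra.
    (* From [x >= 1]: [q^2 = x + 1 <= 2 * x]. It yields [q * (p + q) <= 6 * p^2] below. *)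
    assert (q <= 3 / 2 * p) by nra.
    assert (E : / p - / q = / (p * q * (p + q))).
    { replace (/ p - / q) with ((q * q - p * p) / (p * q * (p + q))) by (field; lra).
      rewrite P2, Q2; replace (x + 1 - x) with 1 by ring; apply Rmult_1_l. }
    rewrite E, <- P2.
    assert (0 < p * q * (p + q)) by (apply Rmult_lt_0_compat; nra).
    assert (0 < p * p * p) by nra.
    assert (p * p * p <= p * q * (p + q)).
    { rewrite !Rmult_assoc; apply Rmult_le_compat_l; nra. }
    assert (p * q * (p + q) <= 6 * (p * p * p)).
    { replace (6 * (p * p * p)) with (p * (6 * (p * p))) by ring.
      rewrite Rmult_assoc; apply Rmult_le_compat_l; nra. }
    split; [split|].
    - now apply Rlt_le, Rinv_0_lt_compat.
    - now apply Rinv_le_contravar.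
    - replace (6 * / (p * q * (p + q))) with (/ (p * q * (p + q) / 6)) by (field; lra).
      apply Rinv_le_contravar; lra. }
  assert (LV : is_lim_seq v 0).
  { apply (is_lim_seq_inv (fun n => sqrt (INR n + INR N)) p_infty); [|discriminate].
    apply (filterlim_comp _ _ _ (fun n => INR n + INR N) sqrt _ (Rbar_locally p_infty)).
    - apply (is_lim_seq_plus _ _ p_infty (INR N)); [apply is_lim_seq_INR|apply is_lim_seq_const|reflexivity].
    - apply filterlim_sqrt_p. }
  assert (SD : is_series d (/ sqrt (INR N))).
  { change (is_lim_seq (sum_n d) (/ sqrt (INR N))).
    apply (is_lim_seq_ext (fun n => / sqrt (INR N) - v (S n))).
    - intros n; induction n as [|n IH].
      + rewrite sum_O; unfold d, v; simpl INR; now rewrite Rplus_0_l.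
      + rewrite sum_Sn, <- IH; unfold d, plus; simpl; ring.
    - replace (Finite (/ sqrt (INR N))) with (Finite (/ sqrt (INR N) - 0)) by (f_equal; ring).
      apply is_lim_seq_minus'; [apply is_lim_seq_const|now apply is_lim_seq_incr_1 in LV]. }
  rewrite <- (is_series_unique _ _ SD); unfold hurwitz_zeta; apply Series_le; [apply B|].
  apply (@ex_series_le R_AbsRing R_CompleteNormedModule) with (fun n => 6 * d n).
  - intros n; unfold norm; simpl; unfold abs; simpl.
    rewrite Rabs_pos_eq; [apply B|]. apply Rle_trans with (d n); apply B.
  - exists (6 * / sqrt (INR N)); now apply (is_series_scal 6 d).
Qed.

(** * Splitting the forward process into a Lipschitz part and jumps *)

Section PiecewiseLipschitz.

Variables (Delta t L : R) (K : nat) (ts xs xm : nat -> R) (f : R -> R).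
Hypothesis HDelta : 0 < Delta.
Hypothesis HL : 0 <= L.
Hypothesis Hts : forall i, (1 <= i <= K)%nat -> t - Delta < ts i < t.
Hypothesis Hmono : forall i, (1 <= i < K)%nat -> ts i < ts (S i).
Hypothesis Hlip : forall i, (i <= K)%nat -> forall s u,
  in_piece Delta t K ts i s -> in_piece Delta t K ts i u ->
  Rabs (f s - f u) <= L * Rabs (s - u).
Hypothesis Hxs : forall i, (1 <= i <= K)%nat -> f (ts i) = xs i.
Hypothesis Hxm : forall i, (1 <= i <= K)%nat ->
  filterlim f (at_left (ts i)) (locally (xm i)).

Let jumps (i : nat) (s : R) : R := sum_1_to i (fun j => (xs j - xm j) * step (ts j) s).

(** The union of the pieces 0 to [i], with the right end treated as in [in_piece]: open, except for
    the last piece. *)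
Let before (i : nat) (s : R) : Prop :=
  t - Delta <= s /\ (if Nat.ltb i K then s < knot Delta t K ts (S i) else s <= t).

Lemma ts_le i j : (1 <= i <= j)%nat -> (j <= K)%nat -> ts i <= ts j.
Proof.
  intros [H1 H2] H3; induction H2 as [|j H2 IH]; [lra|].
  specialize (Hmono j ltac:(lia)); specialize (IH ltac:(lia)); lra.
Qed.

Lemma knot_inner i : (1 <= i <= K)%nat -> knot Delta t K ts i = ts i.
Proof.
  intros Hi; unfold knot.
  replace (Nat.eqb i 0) with false by (symmetry; apply Nat.eqb_neq; lia).
  replace (Nat.leb i K) with true by (symmetry; apply Nat.leb_le; lia).
  reflexivity.
Qed.

Lemma jumps_after i s : (i <= K)%nat -> ((1 <= i)%nat -> ts i <= s) ->
  jumps i s = sum_1_to i (fun j => xs j - xm j).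
Proof.
  intros Hi Hs; apply sum_1_to_ext; intros j Hj.
  rewrite step_1; [ring|]. specialize (Hs ltac:(lia)).
  assert (ts j <= ts i) by (apply ts_le; lia); lra.
Qed.

(** Induction over the pieces. Subtracting the jump at [c = ts (S i)] makes the value at [c] equal
    to the left limit there, so the two sides join continuously and points on opposite sides are
    compared through [c]. *)
Lemma minus_jumps_lipschitz i : (i <= K)%nat -> forall x y,
  before i x -> before i y -> x <= y ->
  Rabs ((f y - jumps i y) - (f x - jumps i x)) <= L * (y - x).
Proof.
  induction i as [|i IH]; intros Hi x y Hx Hy Hxy.
  - unfold jumps, sum_1_to; simpl; rewrite !Rminus_0_r, <- (Rabs_pos_eq (y - x)) by lra.
    apply (Hlip 0 Hi); [exact Hy|exact Hx].
  - set (c := ts (S i)).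
    assert (Hc := Hts (S i) ltac:(lia)); fold c in Hc.
    assert (Kc : knot Delta t K ts (S i) = c) by (apply knot_inner; lia).
    assert (Piece : forall z, before (S i) z -> c <= z -> in_piece Delta t K ts (S i) z).
    { intros z [_ Hz] Hcz; split; [lra|exact Hz]. }
    assert (Pc : in_piece Delta t K ts (S i) c).
    { split; [lra|]. destruct (Nat.ltb_spec (S i) K); [|lra].
      rewrite knot_inner by lia; apply Hmono; lia. }
    assert (Right : forall z, before (S i) z -> c <= z ->
      Rabs ((f z - jumps (S i) z) - (f c - jumps (S i) c)) <= L * (z - c)).
    { intros z Hz Hcz; rewrite !jumps_after by (intros; fold c; lra || lia).
      replace (_ - _ - _) with (f z - f c) by ring.
      rewrite <- (Rabs_pos_eq (z - c)) by lra; apply (Hlip (S i) Hi); auto. }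
    assert (Before : forall z, t - Delta <= z -> z < c -> before i z).
    { intros z Hz Hzc; split; [assumption|].
      replace (Nat.ltb i K) with true by (symmetry; apply Nat.ltb_lt; lia); lra. }
    assert (Old : forall z, z < c -> jumps (S i) z = jumps i z).
    { intros z Hz; unfold jumps; rewrite sum_1_to_S, (step_0 (ts (S i))) by (fold c; lra); ring. }
    assert (Left : forall z, t - Delta <= z -> z < c ->
      Rabs ((f c - jumps (S i) c) - (f z - jumps (S i) z)) <= L * (c - z)).
    { intros z Hz Hzc; rewrite (Old z Hzc).
      assert (Jc : f c - jumps (S i) c = xm (S i) - sum_1_to i (fun j => xs j - xm j)).
      { rewrite jumps_after by (intros; fold c; lra || lia).
        rewrite sum_1_to_S; unfold c; rewrite (Hxs (S i)) by lia; ring. }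
      rewrite Jc; apply le_epsilon; intros e He.
      assert (Lim := Hxm (S i) ltac:(lia)); rewrite filterlim_locally in Lim.
      destruct (Lim (mkposreal e He)) as [r Hr].
      (* A point [w] between [lo] and [c] lies to the right of [z] and of the first [i] observation
         times, where [jumps i] is constant; being close to [c], it has [f w] near the left
         limit. *)
      set (lo := Rmax z (knot Delta t K ts i)).
      assert (Hlo : lo < c).
      { apply Rmax_lub_lt; [assumption|].
        destruct i as [|i]; [simpl; apply Hc|].
        rewrite knot_inner by lia; apply Hmono; lia. }
      set (w := Rmax ((lo + c) / 2) (c - r / 2)).
      assert (Hr0 := cond_pos r).
      assert (Hw : lo < w < c /\ c - r < w).
      { unfold w; repeat split.
        - eapply Rlt_le_trans; [|apply Rmax_l]; lra.
        - apply Rmax_lub_lt; lra.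
        - eapply Rlt_le_trans; [|apply Rmax_r]; lra. }
      assert (Hzw : z <= lo) by apply Rmax_l.
      assert (Hkw : knot Delta t K ts i <= lo) by apply Rmax_r.
      assert (Fw : Rabs (f w - xm (S i)) < e).
      { apply (Hr w); [|fold c; lra].
        unfold ball; simpl; unfold AbsRing_ball, abs, minus, plus, opp; simpl; fold c.
        rewrite Rabs_left; lra. }
      assert (Jw : jumps i w = sum_1_to i (fun j => xs j - xm j)).
      { apply jumps_after; [lia|]; intros H1. rewrite knot_inner in Hkw by lia; lra. }
      assert (IHw := IH ltac:(lia) z w (Before z Hz Hzc) (Before w ltac:(lra) ltac:(lra)) ltac:(lra)).
      rewrite Jw in IHw.
      assert (L * (w - z) <= L * (c - z)) by (apply Rmult_le_compat_l; lra).
      revert Fw IHw; unfold Rabs; repeat destruct Rcase_abs; lra. }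
    destruct (Rlt_le_dec x c) as [Hxc|Hxc]; destruct (Rlt_le_dec y c) as [Hyc|Hyc].
    + rewrite !Old by assumption.
      apply IH; [lia| | |assumption]; apply Before; try assumption; [apply Hx|apply Hy].
    + assert (R1 := Right y Hy Hyc); assert (L1 := Left x (proj1 Hx) Hxc).
      replace (L * (y - x)) with (L * (y - c) + L * (c - x)) by ring.
      replace (f y - jumps (S i) y - (f x - jumps (S i) x)) with
        ((f y - jumps (S i) y - (f c - jumps (S i) c))
         + (f c - jumps (S i) c - (f x - jumps (S i) x))) by ring.
      eapply Rle_trans; [apply Rabs_triang|]; lra.
    + lra.
    + rewrite !jumps_after by (intros; fold c; lra || lia).
      replace (_ - _ - _) with (f y - f x) by ring.
      rewrite <- (Rabs_pos_eq (y - x)) by lra; apply (Hlip (S i) Hi); auto.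
Qed.

Lemma lipschitz_plus_jumps : exists g,
  (forall x y, Rabs (g x - g y) <= L * Rabs (x - y)) /\
  forall s, t - Delta <= s <= t ->
    f s = g s + sum_1_to K (fun i => (xs i - xm i) * step (ts i) s).
Proof.
  set (g := fun s => f s - jumps K s).
  (* Clamping extends [g] from the window to the whole line with the same Lipschitz constant. *)
  exists (fun s => g (clamp (t - Delta) t s)); split.
  - assert (B : forall s, t - Delta <= s <= t -> before K s).
    { intros s Hs; unfold before; rewrite Nat.ltb_irrefl; exact Hs. }
    assert (G : forall x y, t - Delta <= x <= t -> t - Delta <= y <= t ->
      Rabs (g x - g y) <= L * Rabs (x - y)).
    { intros x y Hx Hy; destruct (Rle_dec x y) as [H|H].
      - rewrite Rabs_minus_sym, (Rabs_minus_sym x), (Rabs_pos_eq (y - x)) by lra.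
        apply minus_jumps_lipschitz; auto.
      - rewrite (Rabs_pos_eq (x - y)) by lra.
        apply minus_jumps_lipschitz; auto; lra. }
    intros x y; eapply Rle_trans; [apply G; apply clamp_in; lra|].
    apply Rmult_le_compat_l; [assumption|apply clamp_lipschitz].
  - intros s Hs; rewrite clamp_id by assumption; unfold g, jumps; ring.
Qed.

End PiecewiseLipschitz.

(** * Assembly of the error bound *)

Theorem theorem1 :
  exists C0 C1 C2 : R, 0 < C0 /\ 0 < C1 /\ 0 < C2 /\
  forall (Delta t L : R) (N K : nat)
         (ts xs xm : nat -> R) (xhat xrev : R -> R),
    0 < Delta -> 0 <= L -> (1 <= N)%nat ->
    (* observation times t - Delta < t_1 < ... < t_K < t *)
    (forall i, (1 <= i <= K)%nat -> t - Delta < ts i < t) ->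
    (forall i, (1 <= i < K)%nat -> ts i < ts (S i)) ->
    (* forward process is L-Lipschitz on each piece *)
    (forall i, (i <= K)%nat -> forall s u,
        in_piece Delta t K ts i s -> in_piece Delta t K ts i u ->
        Rabs (xhat s - xhat u) <= L * Rabs (s - u)) ->
    (* reset at the update times, with existing left limits xm i *)
    (forall i, (1 <= i <= K)%nat -> xhat (ts i) = xs i) ->
    (forall i, (1 <= i <= K)%nat ->
        filterlim xhat (at_left (ts i)) (locally (xm i))) ->
    (* reverse reconstruction = orthogonal projection onto degree <= N *)
    is_orth_proj Delta t N xhat xrev ->
    let S_K := sum_1_to K (fun i => Rabs (xm i - xs i)) in
    let xi := hurwitz_zeta (3 / 2) (INR N) in
    mu_norm2 Delta t (fun s => xhat s - xrev s) <=
      C0 * (Delta ^ 2 * L ^ 2 * (INR K + 1) ^ 2) / (INR N * (2 * INR N - 1))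
      + C1 * Delta * L * (INR K + 1) * S_K * xi
      + C2 * S_K ^ 2 * xi.
Proof.
  (* The cross term of the squared Lipschitz constant is absorbed into the two squares, so the
     middle constant may be any positive number. *)
  exists 8, 1, 6; do 3 (split; [lra|]).
  intros Delta t L N K ts xs xm xhat xrev HD HL HN Hts Hmono Hlip Hxs Hxm Hproj Sm xi.
  destruct (lipschitz_plus_jumps Delta t L K ts xs xm xhat HD HL Hts Hmono Hlip Hxs Hxm)
    as (g & Hg & Ef).
  set (J := fun i => xs i - xm i).
  assert (ES : sum_1_to K (fun i => Rabs (J i)) = Sm)
    by (apply sum_1_to_ext; intros; apply Rabs_minus_sym).
  assert (HS : 0 <= Sm) by (apply sum_1_to_nonneg; intros; apply Rabs_pos).
  assert (HN' : 1 <= INR N) by (apply (le_INR 1); assumption).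
  assert (Hr := sqrt_lt_R0 (INR N) ltac:(lra)).
  assert (Hr2 := sqrt_sqrt (INR N) ltac:(lra)).
  assert (Hxi := hurwitz_zeta_3_2_ge N HN); fold xi in Hxi.
  set (r := sqrt (INR N)) in *.
  (* With this width the ramps cost order [Sm^2 / sqrt N], while their slopes contribute order
     [Sm^2 / N] to the Jackson bound; both are controlled by [Sm^2 * xi]. *)
  set (delta := Delta / r).
  assert (Hd : 0 < delta) by (apply Rdiv_lt_0_compat; lra).
  destruct (jumps_ramps_L2 (t - Delta) t delta J ts K ltac:(lra) Hd Hts) as (G & v & IG & Bv & BG).
  rewrite ES in Bv.
  set (F := fun s => g s + sum_1_to K (fun i => J i * ramp (ts i) delta s)).
  assert (HL' : 0 <= L + Sm / delta).
  { apply Rplus_le_le_0_compat; [assumption|].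
    apply Rmult_le_pos; [assumption|apply Rlt_le, Rinv_0_lt_compat; assumption]. }
  assert (HF : forall x y, Rabs (F x - F y) <= (L + Sm / delta) * Rabs (x - y)).
  { intros x y; assert (R1 := ramps_lipschitz delta J ts K x y Hd); rewrite ES in R1.
    specialize (Hg x y); unfold F.
    replace (_ - _) with ((g x - g y) + (sum_1_to K (fun i => J i * ramp (ts i) delta x)
        - sum_1_to K (fun i => J i * ramp (ts i) delta y))) by ring.
    eapply Rle_trans; [apply Rabs_triang|]; lra. }
  assert (CF := cont_lipschitz F _ HL' HF).
  assert (Cg := cont_lipschitz g L HL Hg).
  destruct (jackson_L2 (t - Delta) t ltac:(lra) F _ HL' HF N HN) as (q & Hq & Iq).
  assert (Cq := cont_poly_fun _ _ Hq).
  assert (QI : quad_integrable (t - Delta) t xhat).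
  { apply quad_integrable_ext with (fun s => g s + sum_1_to K (fun i => J i * step (ts i) s));
      [lra| |].
    - intros s Hs; symmetry; apply Ef; lra.
    - apply quad_integrable_jumps; [assumption|now apply quad_integrable_cont]. }
  assert (Best := orth_proj_best Delta t N xhat xrev q HD QI Hproj Hq).
  assert (EG : ex_RInt G (t - Delta) t) by (exists v; exact IG).
  apply (@is_RInt_unique R_CompleteNormedModule) in IG.
  assert (Split : RInt (fun s => (xhat s - q s) ^ 2) (t - Delta) t
    <= 2 * v + 2 * RInt (fun s => (F s - q s) ^ 2) (t - Delta) t).
  { rewrite <- IG, <- !RInt_Rscal by auto with cont.
    assert (E1 : ex_RInt (fun s => 2 * G s) (t - Delta) t)
      by now apply (@ex_RInt_scal R_NormedModule).
    assert (E2 : ex_RInt (fun s => 2 * (F s - q s) ^ 2) (t - Delta) t) by auto with cont.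
    rewrite <- RInt_Rplus by assumption.
    apply RInt_le; [lra|now apply quad_integrable_sqr_minus|now apply (@ex_RInt_plus R_NormedModule)|].
    intros s Hs; specialize (BG s).
    assert (E : xhat s - q s = (sum_1_to K (fun i => J i * step (ts i) s)
        - sum_1_to K (fun i => J i * ramp (ts i) delta s)) + (F s - q s)).
    { rewrite (Ef s) by lra; unfold F, J; ring. }
    rewrite E; set (x := _ - sum_1_to K _) in *; set (y := F s - q s).
    assert (0 <= (x - y) ^ 2) by apply pow2_ge_0; nra. }
  unfold mu_norm2, mu_int.
  apply Rle_trans with (/ Delta * (2 * (Sm ^ 2 * delta)
    + 2 * ((t - (t - Delta)) ^ 3 * (L + Sm / delta) ^ 2 / INR N ^ 2))).
  { apply Rmult_le_compat_l; [apply Rlt_le, Rinv_0_lt_compat; assumption|]; lra. }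
  assert (Hinv : / INR N <= / r).
  { apply Rinv_le_contravar; [assumption|]; nra. }
  (* The 6 collects 2 from the ramps and 4 from their slopes, using [/ INR N <= / r]. *)
  apply Rle_trans with (4 * (Delta ^ 2 * L ^ 2) / INR N ^ 2 + 6 * Sm ^ 2 * / r).
  - assert (EL : / Delta * (2 * (Sm ^ 2 * delta)
      + 2 * ((t - (t - Delta)) ^ 3 * (L + Sm / delta) ^ 2 / INR N ^ 2))
      = 2 * Sm ^ 2 * / r + 2 * (Delta * L + Sm * r) ^ 2 / INR N ^ 2).
    { unfold delta; field; repeat split; lra. }
    rewrite EL.
    assert (E2 : (Sm * r) ^ 2 / INR N ^ 2 = Sm ^ 2 * / INR N)
      by (rewrite <- Hr2; field; lra).
    assert (2 * (Delta * L + Sm * r) ^ 2 / INR N ^ 2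
      <= 4 * (Delta ^ 2 * L ^ 2) / INR N ^ 2 + 4 * ((Sm * r) ^ 2 / INR N ^ 2)).
    { assert (0 < / INR N ^ 2) by (apply Rinv_0_lt_compat; nra).
      apply Rle_trans with ((4 * (Delta ^ 2 * L ^ 2) + 4 * (Sm * r) ^ 2) * / INR N ^ 2);
        [|right; field; lra].
      apply Rmult_le_compat_r; [lra|].
      assert (0 <= (Delta * L - Sm * r) ^ 2) by apply pow2_ge_0; nra. }
    rewrite E2 in *; assert (0 <= Sm ^ 2) by apply pow2_ge_0; nra.
  - assert (HK := pos_INR K).
    assert (0 <= xi) by (eapply Rle_trans; [|exact Hxi]; apply Rlt_le, Rinv_0_lt_compat; assumption).
    assert (T1 : 0 <= 1 * Delta * L * (INR K + 1) * Sm * xi).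
    { repeat apply Rmult_le_pos; lra. }
    assert (T2 : 6 * Sm ^ 2 * / r <= 6 * Sm ^ 2 * xi).
    { apply Rmult_le_compat_l; [|assumption]. assert (0 <= Sm ^ 2) by apply pow2_ge_0; lra. }
    (* The 8 comes from [4 / N^2 = 8 / (2 * N^2) <= 8 / (N * (2 * N - 1))], together with
       [(K + 1)^2 >= 1]. *)
    assert (T0 : 4 * (Delta ^ 2 * L ^ 2) / INR N ^ 2
      <= 8 * (Delta ^ 2 * L ^ 2 * (INR K + 1) ^ 2) / (INR N * (2 * INR N - 1))).
    { replace (4 * (Delta ^ 2 * L ^ 2) / INR N ^ 2)
        with (8 * (Delta ^ 2 * L ^ 2) * / (2 * INR N ^ 2)) by (field; lra).
      assert (0 <= Delta ^ 2 * L ^ 2) by (apply Rmult_le_pos; apply pow2_ge_0).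
      apply Rmult_le_compat.
      - lra.
      - apply Rlt_le, Rinv_0_lt_compat; nra.
      - nra.
      - apply Rinv_le_contravar; nra. }
    lra.
Qed.
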